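(* Let $p$ be a prime and let $n$ be a positive integer with $n<\sqrt p$. Then $$\frac{1}{p-1}\sum_{\chi(-1)=1}\Big|\sum_{m=1}^{n}\chi(m)\Big|^4=\frac{6}{\pi^2}n^2\log n+O(n^2),$$ $$\frac{1}{p-1}\sum_{\chi(-1)=-1}\Big|\sum_{m=1}^{n}\chi(m)\Big|^4=\frac{6}{\pi^2}n^2\log n+O(n^2),$$ where the implied constants are absolute.
   Context: The outer sums run over all Dirichlet characters $\chi$ modulo $p$ (including the principal character) satisfying $\chi(-1)=1$ (even characters), respectively $\chi(-1)=-1$ (odd characters). *)

(* Defs.v *)
From HB Require Import structures.
From mathcomp Require Import all_boot all_order all_algebra.
From mathcomp Require Import all_classical all_reals all_analysis.
From mathcomp Require Import complex.
From mathcomp Require cyclic.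
Set Implicit Arguments.
Unset Strict Implicit.
Unset Printing Implicit Defensive.
Import Order.TTheory GRing.Theory Num.Theory.
Local Open Scope classical_set_scope.
Local Open Scope ring_scope.

(* [chi 1 = 1] follows: [chi 1] is a nonzero idempotent. *)
Definition dirichlet_character (R : realType) (q : nat) (chi : int -> R[i]) :
    Prop :=
  [/\ forall a b : int, chi (a * b) = chi a * chi b,
      forall a : int, chi (a + q%:Z) = chi a
    & forall a : int, (chi a != 0) = coprimez a q%:Z].

Definition even_characters (R : realType) (q : nat) : set (int -> R[i]) :=
  [set chi | dirichlet_character q chi /\ chi (-1) = 1].

Definition odd_characters (R : realType) (q : nat) : set (int -> R[i]) :=
  [set chi | dirichlet_character q chi /\ chi (-1) = -1].

Arguments even_characters : clear implicits.
Arguments odd_characters : clear implicits.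

(* The sums [\sum_(chi \in A) _] are 0 by convention when the summand has
   infinite support on A; the finiteness below shows that this convention never
   applies to sums over Dirichlet characters. *)
Lemma finite_dirichlet_characters (R : realType) (q : nat) : (0 < q)%N ->
  finite_set [set chi : int -> R[i] | dirichlet_character q chi].
Proof.
case: q => // q _.
pose P : {poly R[i]} := 'X^((totient q.+1).+1) - 'X.
have P0 : P != 0.
  apply/eqP => /(congr1 (fun p : {poly R[i]} => p`_1)) /eqP.
  rewrite coefB coefXn coefX coef0 eqSS.
  have /gtn_eqF : (0 < totient q.+1)%N by rewrite totient_gt0.
  by rewrite eq_sym => ->; rewrite sub0r oppr_eq0 oner_eq0.
have [rs Prs] := closed_field_poly_normal P.
pose T := seq_sub rs.
pose g (f : {ffun 'I_q.+1 -> T}) (a : int) : R[i] :=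
  val (f (inord `|(a %% q.+1%:Z)%Z|%N)).
apply: (@sub_finite_set _ _ (g @` setT)); last first.
  exact/finite_image/finite_finset.
move=> chi [chiM chiD chi0].
have chi1 : chi 1 = 1.
  have h : chi 1 != 0 by rewrite chi0 /coprimez gcd1z.
  by apply: (mulfI h); rewrite mulr1 -chiM mulr1.
have chiX a k : chi (a ^+ k) = chi a ^+ k.
  by elim: k => [|k IH]; rewrite ?expr0 ?chi1// !exprS chiM IH.
have chiMn (k : nat) a : chi (a + k%:Z * q.+1%:Z) = chi a.
  elim: k a => [|k IH] a; first by rewrite mul0r addr0.
  by rewrite -addn1 PoszD mulrDl mul1r addrA chiD IH.
have chi_eqn (a b : nat) : a = b %[mod q.+1] -> chi a%:Z = chi b%:Z.
  move=> ab; rewrite (divn_eq a q.+1) (divn_eq b q.+1) ab.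
  by rewrite ![(_ + b %% q.+1)%N]addnC !PoszD !PoszM !chiMn.
have chimod a : chi a = chi (a %% q.+1%:Z)%Z.
  rewrite {1}(divz_eq a q.+1%:Z) addrC.
  case: (a %/ q.+1%:Z)%Z => k; first by rewrite chiMn.
  by rewrite NegzE -(chiMn k.+1) mulNr subrK.
have chirs (n : nat) : chi n%:Z \in rs.
  have [h|h] := boolP (coprime n q.+1); last first.
    have : chi n%:Z = 0 by apply/eqP; rewrite -[_ == _]negbK chi0.
    move=> ->; have : root P 0 by rewrite /root !hornerE /= expr0n subrr.
    rewrite Prs rootZ ?root_prod_XsubC// lead_coef_eq0//.
  have : root P (chi n%:Z).
    rewrite /root !hornerE /= exprS -chiX.
    have -> : chi (n%:Z ^+ totient q.+1) = 1.
      rewrite -chi1 -natz -natrX natz.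
      by apply: chi_eqn; apply: cyclic.Euler_exp_totient.
    by rewrite mulr1 subrr.
  by rewrite Prs rootZ ?root_prod_XsubC// lead_coef_eq0.
exists [ffun i : 'I_q.+1 => SeqSub (chirs i)] => //.
apply/funext => a; rewrite /g ffunE /= [RHS]chimod.
have h : (a %% q.+1%:Z)%Z = `|(a %% q.+1%:Z)%Z|%N%:Z.
  by rewrite gez0_abs// modz_ge0.
rewrite inordK -?h// -ltz_nat -h; exact: ltz_pmod.
Qed.

(* Main.v *)
Require Import Defs.
From mathcomp Require Import all_boot all_order all_algebra all_field.
From mathcomp Require Import all_classical all_reals all_analysis.
From mathcomp Require Import complex.
From mathcomp Require Import zify ring lra.
From mathcomp Require cyclic.
Import Order.TTheory GRing.Theory Num.Theory.
Local Open Scope classical_set_scope.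
Local Open Scope ring_scope.
Set Implicit Arguments.
Unset Strict Implicit.
Unset Printing Implicit Defensive.

(** Expanding the fourth power and using orthogonality of characters, with the
parity condition detected by (1 +- chi(-1))/2, each of the two averages equals
(E +- N)/2. Here E counts the quadruples in [1,n]^4 with ab = cd mod p and N
those with ab = -cd mod p; because n^2 < p, the first congruence is the
equation ab = cd and the second is ab + cd = p ([fourth_moment]).

N is negligible. A solution forces gcd(a,c) = 1, so for fixed a, c the possible
b are congruent modulo c and, symmetrically, the possible d are congruent
modulo a; hence there are at most n/max(a,c) + 1 solutions, and summing over
a, c gives N <= 3 n^2 ([product_sums_to_le]).

E carries the main term. For fixed a, c the pairs (b,d) with ab = cd are the
multiples of (c,a)/gcd(a,c), so E is n sum gcd(a,c)/max(a,c) up to O(n^2).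
Writing gcd(a,c) as the sum of phi(d) over the common divisors d of a and c
turns this into 2 n^2 F(n) + O(n^2) with F(n) = sum_(m <= n) phi(m)/m^2
([product_coincidences_asymptotic]).

It remains to see that F(n) = (6/pi^2) log n + O(1). Summing
m = sum_(d | m) phi(d) gives H(n) = sum_e F(n/e)/e^2 for the harmonic sum H. Put
c = 6/pi^2 and G = F - c H. As c sum_(e <= x) 1/e^2 = 1 + O(1/x), the sum of
G(n/e)/e^2 over e <= n is bounded. Its term e = 1 is G(n) and the
remaining weights add up to at most 3/4 < 1, so G is bounded by strong
induction ([totient_sum_error]); Moebius inversion is thereby avoided.

The value of the sum of 1/e^2, with its error term, comes from
4/sin^2(2x) = 1/sin^2 x + 1/cos^2 x: iterating it from x = pi/4 evaluates the
sum of 1/sin^2 over the odd multiples of pi/2^(k+2) in (0, pi/2), and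
1/x^2 <= 1/sin^2 x <= 1 + 1/x^2 compares that sum with the sum of the inverse
odd squares ([inv_square_sum_asymptotic]). *)

(** * Dirichlet characters modulo a prime *)

Lemma exists_primitive_root (F : numClosedFieldType) (n : nat) :
  (0 < n)%N -> exists z : F, n.-primitive_root z.
Proof.
pose p : {poly F} := 'X^n - 1; have [r Dp] := closed_field_poly_normal p.
move=> n_gt0; rewrite (monicP _) ?monicXnsubC // scale1r in Dp.
have rn1 : all n.-unity_root r by apply/allP=> z; rewrite -root_prod_XsubC -Dp.
have sz_r : (n < (size r).+1)%N.
  by rewrite -(size_prod_XsubC r id) -Dp size_XnsubC.
have [|z] := hasP (cyclic.has_prim_root n_gt0 rn1 _ sz_r); last by exists z.
by rewrite -separable_prod_XsubC -Dp separable_Xn_sub_1 // pnatr_eq0 -lt0n.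
Qed.

Lemma Fp_expf_pred (p : nat) (x : 'F_p) : prime p -> x != 0 -> x ^+ p.-1 = 1.
Proof.
move=> pp x0; apply: (mulfI x0); rewrite mulr1 -exprS prednK ?prime_gt0//.
by have := expf_card x; rewrite card_Fp.
Qed.

Lemma exists_primitive_root_Fp (p : nat) :
  prime p -> exists g : 'F_p, p.-1.-primitive_root g.
Proof.
move=> pp; have p1 : (0 < p.-1)%N by have := prime_gt1 pp; lia.
pose s : seq 'F_p := [seq x <- enum 'F_p | x != 0].
have us : uniq s by rewrite filter_uniq// enum_uniq.
have [| |z] := hasP (cyclic.has_prim_root p1 _ us _); last by exists z.
- apply/allP => x; rewrite mem_filter => /andP[x0 _].
  by rewrite unity_rootE Fp_expf_pred.
rewrite size_filter; have := count_predC (fun x : 'F_p => x != 0) (enum 'F_p).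
rewrite -cardE card_Fp// => h.
have : (count (predC (fun x : 'F_p => (x != 0)%R)) (enum 'F_p) <= 1)%N.
  rewrite (eq_count (a2 := pred1 (0%R : 'F_p))); last by move=> x /=; rewrite negbK.
  by rewrite (count_uniq_mem _ (enum_uniq _)); case: (_ \in _).
move: h; set u := count _ _; set v := count _ _; lia.
Qed.

Lemma Fp_intr_eq0 (p : nat) (a : int) : prime p ->
  (a%:~R == 0 :> 'F_p) = (p%:Z %| a)%Z.
Proof.
move=> pp; have := dvdz_pcharf (pchar_Fp pp) a.
by move=> <-.
Qed.

Lemma Fp_intr_neq0 (p : nat) (a : int) : prime p ->
  (a%:~R != 0 :> 'F_p) = coprimez a p%:Z.
Proof.
move=> pp; rewrite Fp_intr_eq0// coprimezE dvdzE /= coprime_sym.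
by rewrite prime_coprime.
Qed.

Section characters.
Variables (R : realType) (p : nat).
Hypothesis pp : prime p.
Implicit Types (chi : int -> R[i]) (a b : int).

Lemma dirichlet_character1 chi : dirichlet_character p chi -> chi 1 = 1.
Proof.
case=> chiM _ chi0; have h : chi 1 != 0 by rewrite chi0 /coprimez gcd1z.
by apply: (mulfI h); rewrite mulr1 -chiM mulr1.
Qed.

Lemma dirichlet_characterX chi a k :
  dirichlet_character p chi -> chi (a ^+ k) = chi a ^+ k.
Proof.
move=> dchi; have chi1 := dirichlet_character1 dchi; case: dchi => chiM _ _.
by elim: k => [|k IH]; rewrite ?expr0 ?chi1// !exprS chiM IH.
Qed.

(** A character is a function on the prime field, so
identities between residues can be verified in ['F_p]. *)
Lemma dirichlet_character_Fp chi a b : dirichlet_character p chi ->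
  a%:~R = b%:~R :> 'F_p -> chi a = chi b.
Proof.
case=> chiM chiD chi0 /eqP; rewrite -subr_eq0 -rmorphB Fp_intr_eq0//.
move=> /dvdzP[k /(canRL (subrK _))->].
have chiMn (m : nat) c : chi (m%:Z * p%:Z + c) = chi c.
  elim: m c => [|m IH] c; first by rewrite mul0r add0r.
  by rewrite -addn1 PoszD mulrDl mul1r -addrA IH addrC chiD.
case: k => k; first by rewrite chiMn.
by rewrite NegzE -[LHS](chiMn k.+1) mulNr addNKr.
Qed.

End characters.

(** The characters modulo p form a cyclic group; [psi] generates it. Exponents
are taken in [1, p - 1], not [0, p - 2], so that the powers of [psi] vanish at
multiples of p. *)
Definition character_generator (R : realType) (p : nat) (psi : int -> R[i]) :=
  [/\ dirichlet_character p psi,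
      forall a b, coprimez a p%:Z -> psi a = psi b -> (p%:Z %| a - b)%Z,
      exists g, p.-1.-primitive_root (psi g)
    & forall chi, dirichlet_character p chi ->
        exists2 j, (0 < j < p)%N & forall a, chi a = psi a ^+ j].

(** If g is a primitive root modulo p and z a primitive (p-1)-th root of unity,
then g^k |-> z^k generates. *)
Lemma exists_character_generator (R : realType) (p : nat) : prime p ->
  exists psi : int -> R[i], character_generator p psi.
Proof.
move=> pp; have p1 : (0 < p.-1)%N by have := prime_gt1 pp; lia.
have [g gprim] := exists_primitive_root_Fp pp.
have [z zprim] := exists_primitive_root R[i] p1.
have g0 : g != 0.
  apply/eqP => g0; have := prim_expr_order gprim.
  by rewrite g0 expr0n eqn0Ngt p1 => /eqP; rewrite eq_sym oner_eq0.
have z0 : z != 0.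
  apply/eqP => z0; have := prim_expr_order zprim.
  by rewrite z0 expr0n eqn0Ngt p1 => /eqP; rewrite eq_sym oner_eq0.
(* the discrete logarithm to base g, composed with k |-> z^k *)
pose dl (x : 'F_p) : R[i] :=
  if [pick i : 'I_p.-1 | x == g ^+ i] is Some i then z ^+ i else 0.
have gP x : x != 0 -> exists i, x = g ^+ i.
  move=> x0; have := Fp_expf_pred pp x0.
  by move=> /(prim_rootP gprim)[i ->]; exists i.
have dlE k : dl (g ^+ k) = z ^+ k.
  rewrite /dl; case: pickP => [i|/(_ (Ordinal (ltn_pmod k p1)))] /=.
    by rewrite (eq_prim_root_expr gprim) -(eq_prim_root_expr zprim) => /eqP.
  by rewrite (prim_expr_mod gprim) eqxx.
have dl0 : dl 0 = 0.
  rewrite /dl; case: pickP => // i.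
  by rewrite eq_sym expf_eq0 (negPf g0) andbF.
have dl_neq0 x : (dl x != 0) = (x != 0).
  have [->|/gP[i ->]] := eqVneq x 0; first by rewrite dl0 eqxx.
  by rewrite dlE expf_neq0// expf_neq0.
have dlM x y : dl (x * y) = dl x * dl y.
  have [->|/gP[i ->]] := eqVneq x 0; first by rewrite mul0r dl0 mul0r.
  have [->|/gP[j ->]] := eqVneq y 0; first by rewrite mulr0 dl0 mulr0.
  by rewrite -exprD !dlE exprD.
have dl_inj x y : x != 0 -> dl x = dl y -> x = y.
  move=> x0; have := x0; rewrite -dl_neq0 => + e; rewrite e dl_neq0 => /gP[j yj].
  have [i xi] := gP _ x0; move: e; rewrite xi yj !dlE => /eqP.
  by rewrite (eq_prim_root_expr zprim) -(eq_prim_root_expr gprim) => /eqP.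
pose psi (a : int) := dl a%:~R.
have dpsi : dirichlet_character p psi.
  split=> [a b|a|a]; rewrite /psi.
  - by rewrite rmorphM dlM.
  - by rewrite rmorphD /= -pmulrn pchar_Fp_0// addr0.
  - by rewrite dl_neq0 Fp_intr_neq0.
exists psi.
have gE : ((g : nat)%:Z)%:~R = g by rewrite -pmulrn natr_Zp.
split=> // [a b ap||chi dchi].
- rewrite /psi -Fp_intr_neq0// in ap *; move=> /(dl_inj _ _ ap)/eqP.
  by rewrite -subr_eq0 -rmorphB Fp_intr_eq0.
- by exists (g : nat)%:Z; rewrite /psi gE -[g]expr1 dlE expr1.
have chi1 := dirichlet_character1 dchi.
have : chi (g : nat)%:Z ^+ p.-1 = 1.
  rewrite -(dirichlet_characterX _ _ dchi) -chi1.
  apply: (dirichlet_character_Fp pp dchi).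
  by rewrite rmorphXn /= gE (prim_expr_order gprim).
move=> /(prim_rootP zprim)[i iE].
(* exponent 0 would not vanish at multiples of p; p - 1 gives the same values
   at units *)
exists (if i == 0 :> nat then p.-1 else i).
  case: ifP => i0; rewrite ?p1/=; first by rewrite prednK// prime_gt0.
  by rewrite lt0n i0/= (leq_trans (ltn_ord i))// leq_pred.
set j := (if _ then _ else _).
have jE : z ^+ j = z ^+ i.
  rewrite /j; case: eqP => // i0.
  by rewrite (prim_expr_order zprim) i0.
have j0 : (0 < j)%N by rewrite /j lt0n; case: ifPn; rewrite -?lt0n.
move=> a; have [a0|/gP[k ak]] := eqVneq (a%:~R : 'F_p) 0.
  have -> : chi a = 0.
    apply/eqP; rewrite -[_ == _]negbK; case: dchi => _ _ ->.
    by rewrite -Fp_intr_neq0// a0 eqxx.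
  by rewrite /psi a0 dl0 expr0n eqn0Ngt j0.
rewrite /psi ak dlE -exprM mulnC exprM jE -iE.
rewrite -(dirichlet_characterX _ _ dchi).
by apply: (dirichlet_character_Fp pp dchi); rewrite rmorphXn /= gE.
Qed.

(** Orthogonality: the exponents j = 1, ..., q - 1 run over a full period of w. *)
Lemma sum_powers_unity_root (F : fieldType) (q : nat) (w : F) :
  w ^+ q.-1 = 1 ->
  \sum_(1 <= j < q) w ^+ j = if w == 1 then (q.-1)%:R else 0.
Proof.
move=> wq; case: eqVneq => [->|w1].
  by under eq_bigr do rewrite expr1n; rewrite sumr_const_nat subn1.
apply: (mulfI (x := w - 1)); first by rewrite subr_eq0.
rewrite mulr0; case: q wq => [|q] wq; first by rewrite big_geq ?mulr0.
rewrite big_add1 big_mkord /=.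
under eq_bigr do rewrite exprS.
by rewrite -mulr_sumr mulrCA -subrX1 wq subrr mulr0.
Qed.

Definition character_sum (R : realType) (n : nat) (chi : int -> R[i]) : R[i] :=
  \sum_(1 <= m < n.+1) chi m%:Z.

(** The order of summation keeps b, d innermost because the counts are made for
fixed a, c. *)
Definition product_coincidences (n : nat) : nat :=
  \sum_(1 <= a < n.+1) \sum_(1 <= c < n.+1)
  \sum_(1 <= b < n.+1) \sum_(1 <= d < n.+1) (a * b == c * d)%N.

Definition product_sums_to (n p : nat) : nat :=
  \sum_(1 <= a < n.+1) \sum_(1 <= c < n.+1)
  \sum_(1 <= b < n.+1) \sum_(1 <= d < n.+1) (a * b + c * d == p)%N.

Lemma dirichlet_character_order (R : realType) (p : nat) (chi : int -> R[i]) a :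
  prime p -> dirichlet_character p chi -> coprimez a p%:Z -> chi a ^+ p.-1 = 1.
Proof.
move=> pp dchi ap; rewrite -(dirichlet_characterX _ _ dchi).
rewrite -(dirichlet_character1 dchi).
apply: (dirichlet_character_Fp pp dchi).
by rewrite rmorphXn /= Fp_expf_pred// Fp_intr_neq0.
Qed.

Lemma dirichlet_character_conj (R : realType) (p : nat) (chi : int -> R[i]) a :
  prime p -> dirichlet_character p chi -> coprimez a p%:Z ->
  (chi a)^* = (chi a)^-1.
Proof.
move=> pp dchi ap; rewrite invC_norm.
have -> : `|chi a| = 1.
  apply/eqP; rewrite -(@pexpr_eq1 _ _ p.-1)//; last by have := prime_gt1 pp; lia.
  by rewrite -normrX (dirichlet_character_order pp dchi)// normr1.
by rewrite expr1n invr1 mul1r.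
Qed.

(** Since the exponents 1, ..., p - 1 parametrize the characters without
repetition, sums over characters of either parity are sums over exponents. *)
Lemma sum_characters_of_parity (R : realType) (p : nat) (psi : int -> R[i])
    (e : bool) (F : (int -> R[i]) -> R) :
  character_generator p psi ->
  \sum_(chi \in [set chi : int -> R[i] |
          dirichlet_character p chi /\ chi (-1) = (-1) ^+ e]) F chi =
  \sum_(1 <= j < p | psi (-1) ^+ j == (-1) ^+ e) F (fun a => psi a ^+ j).
Proof.
move=> [dpsi _ [g gprim] psiX]; have [psiM psiD psi0] := dpsi.
pose chi_ j : int -> R[i] := fun a => psi a ^+ j.
pose r := [seq j <- index_iota 1 p | psi (-1) ^+ j == (-1) ^+ e].
have ur : uniq r by rewrite filter_uniq// iota_uniq.
have dchi j : (0 < j)%N -> dirichlet_character p (chi_ j).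
  move=> j0; split=> [a b|a|a]; rewrite /chi_.
  - by rewrite psiM exprMn.
  - by rewrite psiD.
  - by rewrite expf_eq0 j0 psi0.
rewrite (reindex_fsbig chi_ [set` r]); last first.
  split.
  - move=> j /=; rewrite mem_filter mem_index_iota => /andP[/eqP sj /andP[j0 _]].
    by split => //; exact: dchi.
  - move=> i j; rewrite !inE /= !mem_filter !mem_index_iota.
    move=> /andP[_ /andP[i0 ip]] /andP[_ /andP[j0 jp]].
    move=> /(congr1 (fun chi => chi g)); rewrite /chi_ => /eqP.
    rewrite -(prednK i0) -(prednK j0) !exprS.
    have g0 : psi g != 0.
      apply/eqP => g0; have := prim_expr_order gprim.
      have p1 : (0 < p.-1)%N by lia.
      by rewrite g0 expr0n eqn0Ngt p1 => /eqP; rewrite eq_sym oner_eq0.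
    rewrite (inj_eq (mulfI g0)) (eq_prim_root_expr gprim).
    by rewrite !modn_small; [move/eqP->|lia|lia].
  - move=> chi /= [/psiX[j /andP[j0 jp] chij] chie].
    exists j => /=; last by apply/funext => a; rewrite chij.
    by rewrite mem_filter mem_index_iota j0 jp -chij chie eqxx.
by rewrite -fsbig_seq// big_filter.
Qed.

(** The parity condition and the fourth power are both polynomial in chi(-1) and
the chi(m), so everything reduces to power sums of w = psi(ab)/psi(cd) and of
psi(-1) w over a full period. As all products lie in [1, n^2] and n^2 < p, these
are equal to 1 exactly when ab = cd and when ab + cd = p. *)
Lemma fourth_moment (R : realType) (p n : nat) (e : bool) :
  prime p -> (n ^ 2 < p)%N ->
  \sum_(chi \in [set chi : int -> R[i] |
          dirichlet_character p chi /\ chi (-1) = (-1) ^+ e])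
    ComplexField.Normc.normc (character_sum n chi) ^+ 4 =
  (p%:R - 1) / 2 * ((product_coincidences n)%:R
                    + (-1) ^+ e * (product_sums_to n p)%:R).
Proof.
move=> pp np; have [psi gpsi] := exists_character_generator R pp.
have [dpsi psi_inj _ _] := gpsi; have [psiM psiD psi0] := dpsi.
pose s := psi (-1).
rewrite (sum_characters_of_parity _ _ gpsi) big_mkcond /= -/s.
have npos m : (1 <= m < n.+1)%N -> coprimez m%:Z p%:Z.
  move=> /andP[m0 mn]; rewrite coprimezE /= coprime_sym prime_coprime//.
  by rewrite gtnNdvd//; nia.
have psi1 := dirichlet_character1 dpsi.
have psi_order a := dirichlet_character_order pp (a := a) dpsi.
have sE : s ^+ 2 = 1 by rewrite expr2 -psiM mulrNN mulr1.
have s_pm : s = 1 \/ s = -1.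
  by move/eqP: sE; rewrite sqrf_eq1 => /orP[]/eqP; [left|right].
have s0 : s != 0 by case: s_pm => ->; rewrite ?oppr_eq0 oner_eq0.
pose w (a c b d : nat) : R[i] := psi a / psi c * (psi b / psi d).
pose I := index_iota 1 n.+1.
(* |S|^2 is a double sum over (a, c); its square is the sum over (a, c, b, d) *)
have absE j : ((ComplexField.Normc.normc (character_sum n (fun a => psi a ^+ j)))%:C)%C ^+ 4 =
    \sum_(a <- I) \sum_(c <- I) \sum_(b <- I) \sum_(d <- I) w a c b d ^+ j.
  have -> : ((ComplexField.Normc.normc (character_sum n (fun a => psi a ^+ j)))%:C)%C =
            `|character_sum n (fun a => psi a ^+ j)| by [].
  rewrite (exprM _ 2 2) normCK [X in X ^+ 2](_ : _ =
     \sum_(a <- I) \sum_(c <- I) (psi a / psi c) ^+ j); last first.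
    rewrite /character_sum rmorph_sum /= mulr_suml; apply: eq_bigr => a _.
    rewrite mulr_sumr big_seq [RHS]big_seq; apply: eq_bigr => c.
    rewrite mem_index_iota => /npos cp.
    by rewrite rmorphXn /= (dirichlet_character_conj pp dpsi cp) exprMn.
  rewrite expr2 mulr_suml; apply: eq_bigr => a _.
  rewrite mulr_suml; apply: eq_bigr => c _.
  rewrite mulr_sumr; apply: eq_bigr => b _.
  rewrite mulr_sumr; apply: eq_bigr => d _.
  by rewrite -exprMn.
(* s^j = +-1, so (1 +- s^j)/2 is the indicator of the parity condition *)
have termE j : ((if s ^+ j == (-1) ^+ e
      then ComplexField.Normc.normc (character_sum n (fun a => psi a ^+ j)) ^+ 4 else 0)%:C)%C
   = 2^-1 * \sum_(a <- I) \sum_(c <- I) \sum_(b <- I) \sum_(d <- I)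
        (w a c b d ^+ j + (-1) ^+ e * (s * w a c b d) ^+ j).
  under eq_bigr do under eq_bigr do under eq_bigr do under eq_bigr do
    rewrite [(s * _) ^+ j]exprMn mulrA -[X in X + _]mul1r -mulrDl.
  under eq_bigr do under eq_bigr do under eq_bigr do rewrite -mulr_sumr.
  under eq_bigr do under eq_bigr do rewrite -mulr_sumr.
  under eq_bigr do rewrite -mulr_sumr.
  rewrite -mulr_sumr -absE mulrA.
  have sj : s ^+ j = 1 \/ s ^+ j = -1.
    case: s_pm => ->; first by left; rewrite expr1n.
    by rewrite -signr_odd; case: odd; [right|left].
  have n11 : (-1 == 1 :> R[i]) = false.
    by apply/negbTE; rewrite -subr_eq0 -opprD oppr_eq0 -(natrD _ 1 1) pnatr_eq0.
  case: (e); case: sj => ->; rewrite ?expr1 ?expr0 ?eqxx ?n11 ?(eq_sym 1) ?n11.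
  - by rewrite mulr1 subrr mulr0 mul0r.
  - by rewrite mulrNN mulr1 mulVf ?pnatr_eq0// mul1r rmorphXn.
  - by rewrite mulr1 mulVf ?pnatr_eq0// mul1r rmorphXn.
  - by rewrite mul1r subrr mulr0 mul0r.
have wp a c b d : a \in I -> c \in I -> b \in I -> d \in I ->
    w a c b d ^+ p.-1 = 1.
  rewrite !mem_index_iota => /npos ap /npos cp /npos bp /npos dp.
  by rewrite !exprMn !exprVn !psi_order// !invr1 !mulr1.
have wE a c b d : a \in I -> c \in I -> b \in I -> d \in I ->
    (w a c b d == 1) = (psi (a * b)%N%:Z == psi (c * d)%N%:Z).
  rewrite !mem_index_iota => /npos ap /npos cp /npos bp /npos dp.
  rewrite /w mulf_div -!psiM.
  have cd0 : psi (c%:Z * d%:Z) != 0 by rewrite psiM mulf_neq0// psi0.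
  by rewrite -(inj_eq (mulIf cd0)) divfK// mul1r.
have IP a : a \in I -> (1 <= a <= n)%N by rewrite mem_index_iota ltnS.
have prodIP a b : a \in I -> b \in I -> (0 < a * b < p)%N.
  by move=> /IP/andP[? ?] /IP/andP[? ?]; apply/andP; split; nia.
have coprime_prod a b : a \in I -> b \in I -> coprimez (a * b)%N%:Z p%:Z.
  move=> /prodIP aI /aI /andP[ab0 abp].
  by rewrite coprimezE /= coprime_sym prime_coprime// gtnNdvd.
have w1E a c b d : a \in I -> c \in I -> b \in I -> d \in I ->
    (w a c b d == 1) = (a * b == c * d)%N.
  move=> aI cI bI dI; rewrite wE//; apply/eqP/eqP => [|->//].
  move=> /(psi_inj _ _ (coprime_prod _ _ aI bI)).
  have /andP[_ abp] := prodIP _ _ aI bI; have /andP[_ cdp] := prodIP _ _ cI dI.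
  by rewrite -eqz_mod_dvd !modz_nat eqz_nat !modn_small// => /eqP.
have sw1E a c b d : a \in I -> c \in I -> b \in I -> d \in I ->
    (s * w a c b d == 1) = (a * b + c * d == p)%N.
  move=> aI cI bI dI; rewrite -(inj_eq (mulfI s0)) mulrA -expr2 sE mul1r mulr1.
  have cd0 : psi (c * d)%N%:Z != 0 by rewrite psi0 coprime_prod.
  have -> : w a c b d = psi (a * b)%N%:Z / psi (c * d)%N%:Z.
    by rewrite /w mulf_div -!psiM.
  rewrite -(inj_eq (mulIf cd0)) divfK// -psiM mulN1r.
  have /andP[ab0 abp] := prodIP _ _ aI bI.
  have /andP[cd1 cdp] := prodIP _ _ cI dI.
  apply/eqP/eqP.
    move=> /(psi_inj _ _ (coprime_prod _ _ aI bI)).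
    rewrite opprK -PoszD dvdzE /= => /dvdnP[k].
    by case: k => [|[|k]]; rewrite ?mul1n//; nia.
  by move=> abcd; rewrite -[RHS]psiD -abcd PoszD addrCA addNr addr0.
apply: (@complexI R).
rewrite rmorph_sum /=; under eq_bigr do rewrite termE.
rewrite -mulr_sumr exchange_big /=.
under eq_bigr do rewrite exchange_big /=.
under eq_bigr do under eq_bigr do rewrite exchange_big /=.
under eq_bigr do under eq_bigr do under eq_bigr do rewrite exchange_big /=.
have inner a c b d : a \in I -> c \in I -> b \in I -> d \in I ->
    \sum_(1 <= j < p) (w a c b d ^+ j + (-1) ^+ e * (s * w a c b d) ^+ j) =
    (p.-1)%:R * ((a * b == c * d)%N%:R + (-1) ^+ e * (a * b + c * d == p)%N%:R).
  move=> aI cI bI dI; rewrite big_split /= -mulr_sumr.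
  rewrite !sum_powers_unity_root ?wp//; last first.
    by rewrite exprMn wp// mulr1 psi_order// /coprimez gcdNz gcd1z.
  rewrite w1E// sw1E// mulrDr mulrCA.
  by congr (_ + _ * _); case: eqP; rewrite ?mulr1 ?mulr0.
have natr_sum4 (f : nat -> nat -> nat -> nat -> nat) :
    (\sum_(a <- I) \sum_(c <- I) \sum_(b <- I) \sum_(d <- I) f a c b d)%N%:R =
    \sum_(a <- I) \sum_(c <- I) \sum_(b <- I) \sum_(d <- I) (f a c b d)%:R
    :> R[i].
  rewrite natr_sum; apply: eq_bigr => a _; rewrite natr_sum; apply: eq_bigr => c _.
  by rewrite natr_sum; apply: eq_bigr => b _; rewrite natr_sum.
transitivity (2^-1 * (p.-1%:R * ((product_coincidences n)%:R +
    (-1) ^+ e * (product_sums_to n p)%:R)) : R[i]); last first.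
  rewrite !(rmorphM, rmorphD, rmorphB) /= fmorphV rmorphXn /= rmorphN1 !rmorph_nat.
  by rewrite -subn1 natrB ?prime_gt0// mulrCA mulrA.
congr (_ * _); rewrite /product_coincidences /product_sums_to !natr_sum4.
rewrite [(-1) ^+ e * _]mulr_sumr -big_split mulr_sumr.
apply: eq_big_seq => a aI; rewrite [(-1) ^+ e * _]mulr_sumr -big_split mulr_sumr.
apply: eq_big_seq => c cI; rewrite [(-1) ^+ e * _]mulr_sumr -big_split mulr_sumr.
apply: eq_big_seq => b bI; rewrite [(-1) ^+ e * _]mulr_sumr -big_split mulr_sumr.
by apply: eq_big_seq => d dI; rewrite inner.
Qed.

(** * The sum of the inverse squares *)

Section basel.
Variable R : realType.
Implicit Types x : R.

Lemma sin_le_self x : 0 <= x -> sin x <= x.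
Proof.
rewrite le_eqVlt => /predU1P[<-|x0]; first by rewrite sin0.
have [|c _] := @MVT R sin cos 0 x x0 (fun c _ => is_derive_sin c).
  by apply: derivable_within_continuous => c _; exact: derivable_sin.
by rewrite sin0 !subr0 => ->; rewrite ler_piMl ?cos_le1// ltW.
Qed.

(** The difference of the two sides vanishes at 0 and has derivative x sin x. *)
Lemma mul_cos_le_sin x : 0 <= x -> x <= pi -> x * cos x <= sin x.
Proof.
rewrite le_eqVlt => /predU1P[<-|x0 xpi]; first by rewrite sin0 mul0r.
pose f := sin - id * (@cos R) : R -> R.
have df (c : R) : is_derive c (1 : R) f (c * sin c).
  apply: is_derive_eq; rewrite /GRing.scale /=; ring.
have [|c] := @MVT R f (fun c => c * sin c) 0 x x0 (fun c _ => df c).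
  by apply: derivable_within_continuous => c _; case: (df c).
rewrite in_itv/= => /andP[c0 cx]; rewrite /f !fctE sin0 mul0r !subr0 => fx.
rewrite -subr_ge0 fx mulr_ge0// ?(ltW x0)// mulr_ge0 ?(ltW c0)//.
by rewrite sin_ge0_pi// (ltW c0) (le_trans (ltW cx)).
Qed.

Lemma inv_sin2_bounds x : 0 < x -> x < pi / 2 ->
  (x ^+ 2)^-1 <= (sin x ^+ 2)^-1 <= 1 + (x ^+ 2)^-1.
Proof.
move=> x0 xpi; have s0 : 0 < sin x by rewrite sin_gt0_pihalf// x0.
have {}xpi' : x <= pi by have := pi_gt0 R; lra.
have c0 : 0 <= cos x by rewrite cos_ge0_pihalf//; have := pi_gt0 R; lra.
have s1 := sin_le_self (ltW x0); have s2 := mul_cos_le_sin (ltW x0) xpi'.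
have h : (sin x ^+ 2)^-1 = 1 + (cos x / sin x) ^+ 2.
  rewrite expr_div_n -[X in X + _](@mulfV _ (sin x ^+ 2)) ?expf_neq0 ?gt_eqF//.
  by rewrite -mulrDl addrC cos2Dsin2 mul1r.
apply/andP; split.
  rewrite lef_pV2 ?posrE ?exprn_gt0//.
  by rewrite lerXn2r ?nnegrE ?(ltW s0) ?(ltW x0).
rewrite h lerD2l -exprVn.
rewrite lerXn2r ?nnegrE ?divr_ge0 ?invr_ge0 ?(ltW s0) ?(ltW x0)//.
by rewrite ler_pdivrMr// mulrC ler_pdivlMr// mulrC.
Qed.

(** The odd multiples of a quarter of pi/M; those below pi/2 have j < M. *)
Definition odd_angle (M j : nat) : R := (j.*2.+1)%:R * (pi / (4 * M%:R)).

Lemma odd_angle_bounds M j : (j < M)%N -> 0 < odd_angle M j < pi / 2.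
Proof.
move=> jM; rewrite /odd_angle; have M0 : 0 < M%:R :> R by rewrite ltr0n; lia.
have pi0 := pi_gt0 R; apply/andP; split.
  by rewrite mulr_gt0 ?ltr0n// divr_gt0// mulr_gt0.
rewrite mulrA ltr_pdivrMr ?mulr_gt0//.
have -> : pi / 2 * (4 * M%:R) = (M.*2)%:R * pi :> R.
  by rewrite -muln2 natrM; field.
by rewrite ltr_pM2r// ltr_nat; lia.
Qed.

Lemma inv_sin2_double x : sin x != 0 -> cos x != 0 ->
  4 * (sin (x *+ 2) ^+ 2)^-1 = (sin x ^+ 2)^-1 + (cos x ^+ 2)^-1.
Proof.
move=> s0 c0; rewrite sin_mulr2n mulr2n.
have -> : (sin x ^+ 2)^-1 + (cos x ^+ 2)^-1 =
          (cos x ^+ 2 + sin x ^+ 2) / (sin x ^+ 2 * cos x ^+ 2).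
  by field; rewrite s0 c0.
by rewrite cos2Dsin2 -mulr2n -mulr_natr; field; rewrite s0 c0.
Qed.

(** Doubling step: halving the angles for M = 2^k gives the first half of the
angles for 2M, and the complements to pi/2 of these halves are the second half. *)
Lemma sum_inv_sin2_odd_angle k :
  \sum_(0 <= j < 2 ^ k) (sin (odd_angle (2 ^ k) j) ^+ 2)^-1 = 2 * 4 ^+ k :> R.
Proof.
elim: k => [|k IH].
  rewrite expn0 big_nat1 /odd_angle mulr1 mul1r expr0 mulr1.
  have := cos_mulr2n (pi / 4 : R).
  have -> : pi / 4 *+ 2 = pi / 2 :> R by field.
  rewrite cos_pihalf sin2cos2 => h.
  have -> : cos (pi / 4 : R) ^+ 2 = 2^-1 by move: h; rewrite mulr2n; lra.
  by field.
rewrite exprS mulrCA -IH mulr_sumr.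
rewrite (@big_cat_nat _ _ _ (2 ^ k)%N) ?leq_exp2l//=.
have -> : \sum_(2 ^ k <= j < 2 ^ k.+1)
      (sin (odd_angle (2 ^ k.+1) j) ^+ 2)^-1 =
    \sum_(0 <= j < 2 ^ k) (cos (odd_angle (2 ^ k.+1) j) ^+ 2)^-1 :> R.
  rewrite big_nat_rev /= -{1}[(2 ^ k)%N]add0n big_addn.
  rewrite expnS mul2n -addnn addnK; apply: eq_big_nat => j /andP[_ jk].
  rewrite -[cos _]cosN -sinDpihalf; congr ((sin _ ^+ 2)^-1).
  rewrite /odd_angle addnn -[(2 ^ k).*2]muln2 natrM.
  have -> : ((2 ^ k + 2 ^ k * 2 - (j + 2 ^ k).+1).*2.+1)%N%:R =
            4 * (2 ^ k)%:R - (j.*2.+1)%:R :> R.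
    rewrite -natrM -natrB; last by lia.
    by congr (_%:R); lia.
  have M0 : (2 ^ k)%:R != 0 :> R by rewrite pnatr_eq0 expn_eq0.
  by field.
rewrite -big_split /=; apply: eq_big_nat => j /andP[_ jk].
have jk2 : (j < 2 ^ k.+1)%N by rewrite expnS; lia.
have /andP[a0 a1] := odd_angle_bounds jk2.
rewrite -inv_sin2_double.
- congr (4 * (sin _ ^+ 2)^-1); rewrite /odd_angle expnS natrM -mulr_natr.
  have M0 : (2 ^ k)%:R != 0 :> R by rewrite pnatr_eq0 expn_eq0.
  by field.
- by rewrite gt_eqF// sin_gt0_pihalf// a0.
- by rewrite gt_eqF// cos_gt0_pihalf//; have := pi_gt0 R; lra.
Qed.

Definition inv_square_sum (n : nat) : R := \sum_(1 <= e < n.+1) (e%:R ^+ 2)^-1.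

(** The even terms up to 2M add up to a quarter of the sum up to M. *)
Lemma sum_odd_inv_square M :
  \sum_(0 <= j < M) ((j.*2.+1)%:R ^+ 2)^-1 =
  inv_square_sum M.*2 - inv_square_sum M / 4.
Proof.
rewrite /inv_square_sum; elim: M => [|M IH].
  by rewrite !big_geq// mul0r subr0.
rewrite big_nat_recr //= IH doubleS !(big_nat_recr _.+1) //=.
rewrite -[in X in _ = X - _]doubleS -[in RHS](muln2 M.+1) natrM.
have M0 : M.+1%:R != 0 :> R by rewrite pnatr_eq0.
have M1 : M.*2.+1%:R != 0 :> R by rewrite pnatr_eq0.
move: M0 M1; move: (M.+1%:R : R) (M.*2.+1%:R : R) => u v u0 v0.
by field; rewrite u0 v0.
Qed.

(** Compare 1/sin^2 with 1/x^2 termwise: the 2^k error terms are each at most 1,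
against a total of 2 4^k. *)
Lemma sum_odd_inv_square_bounds k :
  1 - (2 * (2 ^ k)%:R)^-1 <=
    8 / (pi : R) ^+ 2 * \sum_(0 <= j < 2 ^ k) ((j.*2.+1)%:R ^+ 2)^-1 <= 1.
Proof.
set O := \sum_(0 <= j < _) _.
have pi0 := pi_gt0 R.
have M0 : 0 < (2 ^ k)%:R :> R by rewrite ltr0n expn_gt0.
have E : \sum_(0 <= j < 2 ^ k) (odd_angle (2 ^ k) j ^+ 2)^-1 =
    8 / pi ^+ 2 * O * (2 * (2 ^ k)%:R ^+ 2).
  rewrite /O mulrAC mulr_sumr; apply: eq_bigr => j _; rewrite /odd_angle.
  have j0 : (j.*2.+1)%:R != 0 :> R by rewrite pnatr_eq0.
  move: j0 M0 pi0; move: (j.*2.+1%:R : R) ((2 ^ k)%:R : R) (pi : R) => u v w.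
  by move=> u0 v0 w0; field; rewrite u0 !gt_eqF.
have M2 : (2 * 4 ^+ k : R) = 2 * (2 ^ k)%:R ^+ 2.
  by rewrite natrX -exprM mulnC exprM; congr (_ * _ ^+ _); rewrite expr2 -natrM.
have M3 : 0 < 2 * (2 ^ k)%:R ^+ 2 :> R by rewrite mulr_gt0// exprn_gt0.
rewrite -(ler_pM2r M3) -[X in _ && X](ler_pM2r M3) mul1r -E -M2.
rewrite -sum_inv_sin2_odd_angle; apply/andP; split; last first.
  apply: ler_sum_nat => j /andP[_ jk].
  by have /andP[/inv_sin2_bounds h /h /andP[]] := odd_angle_bounds jk.
rewrite mulrBl mul1r sum_inv_sin2_odd_angle {2}M2 lerBlDl.
rewrite -{1}sum_inv_sin2_odd_angle.
have -> : (2 * (2 ^ k)%:R)^-1 * (2 * (2 ^ k)%:R ^+ 2) =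
          \sum_(0 <= j < 2 ^ k) 1 :> R.
  by rewrite sumr_const_nat subn0; field; rewrite gt_eqF.
rewrite -big_split /=; apply: ler_sum_nat => j /andP[_ jk].
by have /andP[/inv_sin2_bounds h /h /andP[]] := odd_angle_bounds jk.
Qed.

(** Telescoping: 1/(m+1)^2 <= 1/m - 1/(m+1). *)
Lemma inv_square_sum_tail m n : (0 < n <= m)%N ->
  0 <= inv_square_sum m - inv_square_sum n <= n%:R^-1.
Proof.
move=> /andP[n0 nm]; rewrite /inv_square_sum.
rewrite (@big_cat_nat _ _ _ n.+1 1 m.+1) //= [X in X - _]addrC addrK; apply/andP; split.
  by apply: sumr_ge0 => e _; rewrite invr_ge0 exprn_ge0.
have n0' : 0 < n%:R :> R by rewrite ltr0n.
apply: (@le_trans _ _ (n%:R^-1 - m%:R^-1)); last by rewrite gerBl invr_ge0.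
elim: m nm => [|m IH]; first by rewrite leqn0 => /eqP n00; rewrite n00 in n0.
rewrite leq_eqVlt => /predU1P[->|]; first by rewrite big_geq// subrr.
rewrite ltnS => nm; rewrite big_nat_recr//=.
have m0 : 0 < m%:R :> R by rewrite ltr0n (leq_trans n0).
apply: le_trans (lerD (IH nm) (lexx _)) _.
rewrite -subr_ge0 -natr1.
have -> : n%:R^-1 - (m%:R + 1)^-1 - (n%:R^-1 - m%:R^-1 + ((m%:R + 1) ^+ 2)^-1) =
    (m%:R * (m%:R + 1) ^+ 2)^-1 :> R.
  by field; rewrite !gt_eqF// addr_gt0.
by rewrite invr_ge0 mulr_ge0 ?ltW// exprn_gt0// addr_gt0.
Qed.

(** An effective form of zeta(2) = pi^2/6. The sum up to n is compared, with
tails at most 1/n, with the sums up to M and 2M for M = 2^n, which the sum of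
inverse odd squares controls with error at most 1/M; no limit is needed. *)
Lemma inv_square_sum_asymptotic n : (0 < n)%N ->
  `|1 - 6 / pi ^+ 2 * inv_square_sum n| <= 3 / n%:R.
Proof.
move=> n0; have n0' : 0 < n%:R :> R by rewrite ltr0n.
(* the power of 2 only has to be at least n, to make the error 1/M at most 1/n *)
have nM : (n <= 2 ^ n)%N by rewrite ltnW// ltn_expl.
have := sum_odd_inv_square_bounds n; rewrite sum_odd_inv_square.
have /inv_square_sum_tail : (0 < n <= 2 ^ n)%N by rewrite n0.
have /inv_square_sum_tail : (0 < n <= (2 ^ n).*2)%N by rewrite n0/=; lia.
set A := inv_square_sum n; set B := inv_square_sum _; set C := inv_square_sum _.
move=> /andP[B0 B1] /andP[C0 C1] /andP[].
have c2 : 8 / pi ^+ 2 <= 2 :> R.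
  rewrite ler_pdivrMr ?exprn_gt0 ?pi_gt0//.
  have := pi_ge2 R; nra.
have c0 : 0 <= 8 / pi ^+ 2 :> R by rewrite divr_ge0// exprn_ge0// pi_ge0.
have pi0 : pi != 0 :> R by rewrite gt_eqF// pi_gt0.
have -> : 6 / pi ^+ 2 * A = 3 / 4 * (8 / pi ^+ 2) * A.
  by move: pi0; move: (pi : R) => w w0; field.
have tE : 3 / n%:R = 3 * n%:R^-1 :> R by [].
have Mn : (2 * (2 ^ n)%:R)^-1 <= n%:R^-1 :> R.
  rewrite lef_pV2 ?posrE ?mulr_gt0 ?ltr0n ?expn_gt0//.
  by rewrite -natrM ler_nat; lia.
move=> h1 h2; rewrite ler_norml tE; move: h1 h2 c0 c2 Mn B0 B1 C0 C1.
set c := 8 / _; set q := n%:R^-1; set t := (_)^-1 => *.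
by apply/andP; split; nra.
Qed.
End basel.

(** * Averages of the totient function *)

Lemma sum_multiples (V : nmodType) (f : nat -> V) (d n : nat) : (0 < d)%N ->
  \sum_(1 <= m < n.+1 | (d %| m)%N) f m =
  \sum_(1 <= e < (n %/ d).+1) f (d * e)%N.
Proof.
move=> d0; elim: n => [|n IH]; first by rewrite div0n !big_geq.
rewrite big_mkcond big_nat_recr //= -big_mkcond IH /=.
have [dn|dn] := boolP (d %| n.+1)%N.
  move: (dn) => /dvdnP[k nE]; rewrite nE mulnK//.
  have k0 : (0 < k)%N by case: k nE.
  have kE : (n %/ d).+1 = k.
    have -> : n = ((k.-1) * d + d.-1)%N by nia.
    by rewrite divnMDl// divn_small; lia.
  by rewrite [RHS]big_nat_recr//= kE [(k * d)%N]mulnC.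
by rewrite addr0 divnS// (negPf dn).
Qed.

(** Both sides run over the pairs (d, e) with de <= n. *)
Lemma sum_hyperbola (V : nmodType) (g : nat -> nat -> V) (n : nat) :
  \sum_(1 <= d < n.+1) \sum_(1 <= e < (n %/ d).+1) g d e =
  \sum_(1 <= e < n.+1) \sum_(1 <= d < (n %/ e).+1) g d e.
Proof.
have widen (h : nat -> V) k : (0 < k)%N ->
    \sum_(1 <= e < (n %/ k).+1) h e = \sum_(1 <= e < n.+1 | (e * k <= n)%N) h e.
  move=> k0; rewrite (big_nat_widen _ _ n.+1) ?ltnS ?leq_div//.
  by apply: eq_bigl => e; rewrite ltnS leq_divRL.
transitivity (\sum_(1 <= d < n.+1) \sum_(1 <= e < n.+1 | (e * d <= n)%N) g d e).
  by apply: eq_big_nat => d /andP[d0 _]; rewrite widen.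
rewrite (exchange_big_dep xpredT)//=; apply: eq_big_nat => e /andP[e0 _].
by rewrite widen//; apply: eq_bigl => d; rewrite mulnC.
Qed.

Lemma sum_totient_divisors m n : (0 < m <= n)%N ->
  (\sum_(1 <= d < n.+1 | d %| m) totient d)%N = m.
Proof.
move=> /andP[m0 mn]; rewrite -[RHS]cyclic.sum_totient_dvd.
rewrite -(big_mkord (fun d => d %| m)%N) [RHS]big_ltn_cond//= dvd0n gtn_eqF//.
rewrite [RHS](big_nat_widen _ _ n.+1)//; apply: eq_bigl => d; rewrite ltnS.
by case: (boolP (d %| m)%N) => //= /(dvdn_leq m0).
Qed.

Section harmonic_totient.
Variable R : realType.

Definition harmonic_sum (n : nat) : R := \sum_(1 <= m < n.+1) m%:R^-1.

Definition totient_sum (n : nat) : R :=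
  \sum_(1 <= m < n.+1) (totient m)%:R / m%:R ^+ 2.

(** Induction in the form ln(n+1) <= H(n) <= 1 + ln n, each step being
1/(m+1) <= ln(m+1) - ln m <= 1/m. *)
Lemma harmonic_sum_ln n : (0 < n)%N ->
  0 <= harmonic_sum n - ln n%:R <= 1.
Proof.
move=> n0; suff : ln n.+1%:R <= harmonic_sum n <= 1 + ln n%:R.
  have : ln (n%:R : R) <= ln n.+1%:R by rewrite ler_ln ?posrE ?ltr0n// ler_nat.
  lra.
have step m : (0 < m)%N -> m.+1%:R^-1 <= ln (m.+1%:R : R) - ln m%:R <= m%:R^-1.
  move=> m0; have m0' : 0 < m%:R :> R by rewrite ltr0n.
  have m1 : 0 < m.+1%:R :> R by rewrite ltr0n.
  have m1E : m.+1%:R = m%:R + 1 :> R by rewrite natr1.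
  apply/andP; split.
    rewrite -opprB lerNr -ln_div ?posrE//.
    have -> : m%:R / m.+1%:R = 1 + - m.+1%:R^-1 :> R.
      by rewrite m1E; field; rewrite -m1E gt_eqF.
    by apply: le_ln1Dx; rewrite ltrN2 invf_lt1// ltr1n.
  rewrite -ln_div ?posrE//.
  have -> : m.+1%:R / m%:R = 1 + m%:R^-1 :> R by rewrite m1E; field; rewrite gt_eqF.
  by apply: le_ln1Dx; rewrite (@lt_trans _ _ 0) ?ltrN10// invr_gt0.
rewrite /harmonic_sum; elim: n n0 => // -[_ _|n IH _].
  rewrite big_nat1 invr1 ln1 addr0 lexx andbT.
  by have /andP[_] := step 1%N isT; rewrite ln1 subr0 invr1.
rewrite big_nat_recr//=.
have := IH isT; have := step n.+1 isT; have := step n.+2 isT.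
move: (\sum_(1 <= i < n.+2) _ : R) (n.+1%:R^-1 : R) (n.+2%:R^-1 : R)
  (n.+3%:R^-1 : R) (ln n.+1%:R : R) (ln n.+2%:R : R) (ln n.+3%:R : R).
move=> *; lra.
Qed.

(** Write 1/m as the sum of phi(d)/m^2 over d | m and set m = de. *)
Lemma harmonic_sum_convolution n :
  harmonic_sum n = \sum_(1 <= e < n.+1) totient_sum (n %/ e) / e%:R ^+ 2.
Proof.
rewrite /harmonic_sum /totient_sum.
transitivity (\sum_(1 <= m < n.+1) \sum_(1 <= d < n.+1 | (d %| m)%N)
    ((totient d)%:R / m%:R ^+ 2 : R)).
  apply: eq_big_nat => m mn; have /andP[m0 _] := mn.
  rewrite -mulr_suml -natr_sum sum_totient_divisors//.
  have m0' : m%:R != 0 :> R by rewrite pnatr_eq0 -lt0n.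
  by field.
rewrite (exchange_big_dep xpredT)//=.
transitivity (\sum_(1 <= d < n.+1) \sum_(1 <= e < (n %/ d).+1)
    ((totient d)%:R / (d * e)%:R ^+ 2 : R)).
  apply: eq_big_nat => d /andP[d0 _].
  by rewrite (sum_multiples (fun m => (totient d)%:R / m%:R ^+ 2)).
rewrite (sum_hyperbola (fun d e => (totient d)%:R / (d * e)%:R ^+ 2)).
apply: eq_big_nat => e _; rewrite mulr_suml; apply: eq_bigr => d _.
by rewrite natrM exprMn invfM mulrA.
Qed.

(** Both sides are the sum of 1/(d e^2) over the pairs with de <= n. *)
Lemma harmonic_convolution_inv_square n :
  \sum_(1 <= e < n.+1) harmonic_sum (n %/ e) / e%:R ^+ 2 =
  \sum_(1 <= d < n.+1) inv_square_sum R (n %/ d) / d%:R.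
Proof.
transitivity (\sum_(1 <= e < n.+1) \sum_(1 <= d < (n %/ e).+1)
    (d%:R^-1 / e%:R ^+ 2 : R)).
  by apply: eq_bigr => e _; rewrite mulr_suml.
rewrite -(sum_hyperbola (fun d e => d%:R^-1 / e%:R ^+ 2)).
by apply: eq_bigr => d _; rewrite -mulr_sumr mulrC.
Qed.

Lemma inv_square_sum_le n : inv_square_sum R n <= 7 / 4.
Proof.
case: n => [|[|n]].
- by rewrite /inv_square_sum big_geq//; lra.
- by rewrite /inv_square_sum big_nat1 expr1n; lra.
have /(inv_square_sum_tail R)/andP[_] : (0 < 2 <= n.+2)%N by [].
have -> : inv_square_sum R 2 = 5 / 4.
  by rewrite /inv_square_sum big_nat_recr//= big_nat1; field.
lra.
Qed.

(** The deviation G satisfies a bounded convolution identity in which the term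
e = 1 dominates: the other weights 1/e^2 add up to at most 3/4. The bound 24 is
the fixed point of M |-> 6 + 3/4 M. *)
Lemma totient_sum_error n : (0 < n)%N ->
  `|totient_sum n - 6 / pi ^+ 2 * harmonic_sum n| <= 24.
Proof.
pose c : R := 6 / pi ^+ 2.
pose G k := totient_sum k - c * harmonic_sum k.
have sumG m : (0 < m)%N -> `|\sum_(1 <= e < m.+1) G (m %/ e)%N / e%:R ^+ 2| <= 6.
  move=> m0.
  have -> : \sum_(1 <= e < m.+1) G (m %/ e)%N / e%:R ^+ 2 =
      \sum_(1 <= d < m.+1) (1 - c * inv_square_sum R (m %/ d)) / d%:R.
    under eq_bigr do rewrite mulrBl -mulrA.
    rewrite sumrB -harmonic_sum_convolution -mulr_sumr.
    rewrite harmonic_convolution_inv_square mulr_sumr -sumrB.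
    by apply: eq_bigr => d _; rewrite mulrBl mul1r mulrA.
  apply: le_trans (ler_norm_sum _ _ _) _.
  (* with A(x) the sum of 1/e^2 for e <= x, |1 - c A(m/d)| is at most
     3/(m/d) <= 6 d/m, so each of the m terms is at most 6/m *)
  apply: (@le_trans _ _ (\sum_(1 <= d < m.+1) (6 / m%:R))); last first.
    by rewrite sumr_const_nat subn1 -[leLHS]mulr_natr divfK// pnatr_eq0 -lt0n.
  apply: ler_sum_nat => d /andP[d0 dm].
  have md : (0 < m %/ d)%N by rewrite divn_gt0.
  have d0' : 0 < d%:R :> R by rewrite ltr0n.
  have m0' : 0 < m%:R :> R by rewrite ltr0n.
  have md' : 0 < (m %/ d)%:R :> R by rewrite ltr0n.
  rewrite normrM normfV (ger0_norm (ltW d0')) ler_pdivrMr//.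
  apply: le_trans (inv_square_sum_asymptotic R md) _.
  rewrite ler_pdivrMr// -[leRHS]mulrA mulrAC ler_pdivlMr//.
  rewrite -!natrM ler_nat.
  have := ltn_ceil m d0; nia.
have tail m : (0 < m)%N -> \sum_(2 <= e < m.+1) (e%:R ^+ 2)^-1 <= 3 / 4 :> R.
  move=> m0; have := inv_square_sum_le m.
  by rewrite /inv_square_sum big_ltn// expr1n invr1; lra.
elim/ltn_ind: n => n IH n0; rewrite -/c -/(G n).
have := sumG n n0; rewrite big_ltn// divn1 expr1n divr1.
set S := \sum_(_ <= _ < _) _ => h.
have : `|S| <= 18.
  apply: le_trans (ler_norm_sum _ _ _) _.
  apply: (@le_trans _ _ (\sum_(2 <= e < n.+1) (24 * (e%:R ^+ 2)^-1))); last first.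
    by rewrite -mulr_sumr; have := tail n n0; lra.
  apply: ler_sum_nat => e /andP[e2 en].
  rewrite normrM normfV (ger0_norm (exprn_ge0 _ _))//.
  rewrite ler_wpM2r ?invr_ge0 ?exprn_ge0//.
  by apply: IH; rewrite ?divn_gt0 ?ltn_Pdiv// (leq_trans _ e2).
move: h; rewrite !ler_norml; lra.
Qed.

Lemma totient_sum_asymptotic n : (0 < n)%N ->
  `|totient_sum n - 6 / pi ^+ 2 * ln n%:R| <= 26.
Proof.
move=> n0; have := totient_sum_error n0; have := harmonic_sum_ln n0.
have c2 : 6 / pi ^+ 2 <= 2 :> R.
  by rewrite ler_pdivrMr ?exprn_gt0 ?pi_gt0//; have := pi_ge2 R; nra.
have c0 : 0 <= 6 / pi ^+ 2 :> R by rewrite divr_ge0// exprn_ge0// pi_ge0.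
move: c0 c2; rewrite !ler_norml; set c := 6 / _ => *; nra.
Qed.
End harmonic_totient.

(** * Counting quadruples *)

(** Cut the square along its diagonal. *)
Lemma sum_square_symmetric (V : comNzRingType) (f : nat -> nat -> V) (n : nat) :
  (forall a c, f a c = f c a) ->
  \sum_(1 <= a < n.+1) \sum_(1 <= c < n.+1) f a c =
  2 * (\sum_(1 <= c < n.+1) \sum_(1 <= a < c.+1) f a c)
  - \sum_(1 <= a < n.+1) f a a.
Proof.
move=> fC; elim: n => [|n IH]; first by rewrite !big_geq// mulr0 subr0.
rewrite !(big_nat_recr n.+1)//=.
under eq_bigr do rewrite big_nat_recr//=.
under [X in _ + (X + _)]eq_bigr do rewrite fC.
by rewrite big_split /= IH; ring.
Qed.

Lemma sum_indicator_solution n c x q : (0 < c)%N ->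
  (\sum_(1 <= d < n.+1) (x + c * d == q)%N <= ((x <= q) && (c %| q - x)))%N.
Proof.
move=> c0; have [/hasP[d dI /eqP dq]|/hasPn no] :=
  boolP (has (fun d => x + c * d == q)%N (index_iota 1 n.+1)); last first.
  by rewrite big1_seq// => d /andP[_ /no /negbTE ->].
rewrite -dq leq_addr addKn dvdn_mulr//= (big_rem d)//= eqxx big1_seq// => e.
rewrite rem_filter ?iota_uniq// mem_filter => /andP[_ /andP[/= ed _]].
by rewrite eqn_add2l eqn_pmul2l// (negPf ed).
Qed.

Lemma count_multiples d n : (0 < d)%N ->
  (\sum_(1 <= m < n.+1) (d %| m))%N = (n %/ d)%N.
Proof.
move=> d0; rewrite (eq_bigr (fun m => if (d %| m)%N then 1%N else 0%N)).
  by rewrite -big_mkcond sum_multiples// sum_nat_const_nat subn1 muln1.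
by move=> m _; case: (_ %| _)%N.
Qed.

(** If b is the largest solution, the others differ from it by multiples of c. *)
Lemma count_congruent (P : pred nat) (c n : nat) : (0 < c)%N ->
  (forall b b', b <= b' -> P b -> P b' -> c %| b' - b)%N ->
  (\sum_(1 <= b < n.+1) P b <= n %/ c + 1)%N.
Proof.
move=> c0 Pc; elim: n => [|n IH]; first by rewrite big_geq.
rewrite big_nat_recr//=; have [Pn|Pn] := boolP (P n.+1); last first.
  by rewrite addn0 (leq_trans IH)// leq_add2r leq_div2r.
rewrite leq_add2r (@leq_trans (n %/ c))//; last by rewrite leq_div2r.
rewrite big_nat_rev /= -count_multiples// big_seq [leqRHS]big_seq.
apply: leq_sum => t; rewrite mem_index_iota => /andP[t1 tn].
have [Pt|//] := boolP (P _).
have -> : t = (n.+1 - (1 + n.+1 - t.+1))%N by lia.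
by rewrite Pc//; lia.
Qed.

(** Say a <= c. By Gauss' lemma b must be a multiple of c/gcd(a,c), and then
d = ab/c <= b lies in [1, n] automatically. *)
Lemma count_equal_products a c n : (0 < a <= n)%N -> (0 < c <= n)%N ->
  (\sum_(1 <= b < n.+1) \sum_(1 <= d < n.+1) (a * b == c * d))%N =
  (n %/ (maxn a c %/ gcdn a c))%N.
Proof.
wlog ac : a c / (a <= c)%N => [hw|].
  have [ac|ca] := orP (leq_total a c); first exact: hw.
  move=> an cn; rewrite maxnC gcdnC -hw// exchange_big /=.
  by apply: eq_bigr => b _; apply: eq_bigr => d _; rewrite eq_sym.
move=> /andP[a0 an] /andP[c0 cn]; rewrite (maxn_idPr ac).
have g0 : (0 < gcdn a c)%N by rewrite gcdn_gt0 a0.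
have q0 : (0 < c %/ gcdn a c)%N by rewrite divn_gt0// dvdn_leq// dvdn_gcdr.
rewrite -count_multiples//; apply: eq_big_nat => b /andP[b1 bn].
have cop : coprime (c %/ gcdn a c) (a %/ gcdn a c).
  rewrite /coprime -(eqn_pmul2l g0) muln1 muln_gcdr.
  by rewrite ![(gcdn a c * _)%N]mulnC !divnK ?dvdn_gcdl ?dvdn_gcdr// gcdnC.
have -> : (c %/ gcdn a c %| b)%N = (c %| a * b)%N.
  rewrite -(Gauss_dvdr b cop) -(@dvdn_pmul2r (gcdn a c))// divnK ?dvdn_gcdr//.
  by rewrite mulnAC divnK// dvdn_gcdl.
have [/dvdnP[k kE]|cab] := boolP (c %| a * b)%N; last first.
  rewrite big1// => d _; case: eqP => // abE.
  by rewrite abE dvdn_mulr in cab.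
have kb : (0 < k < n.+1)%N by nia.
rewrite (bigD1_seq k) ?mem_index_iota ?iota_uniq//= kE mulnC eqxx big1// => d dk.
by rewrite eqn_pmul2l// eq_sym (negPf dk).
Qed.

(** Say a <= c. A solution makes a and c coprime, since gcd(a,c) <= n < p divides
p. Then ab = p mod c fixes b modulo c, and b determines d. *)
Lemma count_products_sum_to a c n p : prime p -> (n < p)%N ->
  (0 < a <= n)%N -> (0 < c <= n)%N ->
  (\sum_(1 <= b < n.+1) \sum_(1 <= d < n.+1) (a * b + c * d == p)
   <= n %/ maxn a c + 1)%N.
Proof.
move=> pp np; wlog ac : a c / (a <= c)%N => [hw|].
  have [ac|ca] := orP (leq_total a c); first exact: hw.
  move=> an cn; rewrite maxnC exchange_big /= (leq_trans _ (hw _ _ ca cn an))//.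
  by apply: leq_sum => b _; apply: leq_sum => d _; rewrite addnC.
move=> /andP[a0 an] /andP[c0 cn]; rewrite (maxn_idPr ac).
have [ac1|ac1] := boolP (coprime c a); last first.
  rewrite big1// => b _; rewrite big1// => d _; apply/eqP; rewrite eqb0.
  apply: contra ac1 => /eqP abcd.
  have : (gcdn c a %| p)%N.
    by rewrite -abcd dvdn_add// dvdn_mulr// ?dvdn_gcdl ?dvdn_gcdr.
  case/primeP: (pp) => _ /[apply] /orP[|/eqP gp].
    by rewrite /coprime gcdnC.
  by have := dvdn_leq c0 (dvdn_gcdl c a); lia.
rewrite (@leq_trans (\sum_(1 <= b < n.+1) ((a * b <= p) && (c %| p - a * b))))//.
  by apply: leq_sum => b _; exact: sum_indicator_solution.
apply: count_congruent => // b b' bb' /andP[abp cb] /andP[ab'p cb'].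
rewrite -(Gauss_dvdr _ ac1).
have -> : (a * (b' - b) = (p - a * b) - (p - a * b'))%N by nia.
exact: dvdn_sub.
Qed.

Lemma totient_le n : (totient n <= n)%N.
Proof.
rewrite -[leqRHS]cyclic.sum_totient_dvd (bigD1 (ord_max : 'I_n.+1)) ?dvdnn//=.
exact: leq_addr.
Qed.

Section real_counts.
Variable R : realType.

Lemma divn_bounds n q : (0 < q)%N ->
  n%:R / q%:R - 1 <= ((n %/ q)%:R : R) <= n%:R / q%:R.
Proof.
move=> q0; have q0' : 0 < q%:R :> R by rewrite ltr0n.
rewrite lerBlDr ler_pdivrMr// ler_pdivlMr// natr1 -!natrM !ler_nat.
by rewrite leq_divM andbT ltnW// ltn_ceil.
Qed.

(** Expand gcd(a,c) into the sum of phi(d) over common divisors and count the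
c/d multiples of d up to c. *)
Lemma sum_totient_divisors_ratio c n : (0 < c <= n)%N ->
  \sum_(1 <= a < c.+1) (gcdn a c)%:R / (maxn a c)%:R =
  \sum_(1 <= d < n.+1 | (d %| c)%N) (totient d)%:R / d%:R :> R.
Proof.
move=> /andP[c0 cn]; have c0' : c%:R != 0 :> R by rewrite pnatr_eq0 -lt0n.
transitivity (\sum_(1 <= a < c.+1) \sum_(1 <= d < n.+1 | (d %| gcdn a c)%N)
    ((totient d)%:R / c%:R : R)).
  apply: eq_big_nat => a /andP[a0 ac]; rewrite (maxn_idPr _)//.
  rewrite -mulr_suml -natr_sum sum_totient_divisors//.
  by rewrite gcdn_gt0 a0/= (leq_trans _ cn)// dvdn_leq// dvdn_gcdr.
rewrite (exchange_big_dep (fun d => d %| c)%N)/=; last first.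
  by move=> a d _; rewrite dvdn_gcd => /andP[].
rewrite big_nat_cond [RHS]big_nat_cond.
apply: eq_bigr => d /andP[/andP[d0 _] dc].
rewrite (eq_bigl (fun a => d %| a)%N); last by move=> a; rewrite dvdn_gcd dc andbT.
rewrite sum_multiples// sumr_const_nat subn1 /= -[LHS]mulr_natr.
have d0' : d%:R != 0 :> R by rewrite pnatr_eq0 -lt0n.
have cE : c%:R = (c %/ d)%:R * d%:R :> R by rewrite -natrM divnK.
have q0 : (c %/ d)%:R != 0 :> R by move: c0'; rewrite cE mulf_eq0 negb_or => /andP[].
by rewrite -mulrA cE invfM mulrAC mulVf// mul1r.
Qed.

Lemma sum_gcd_over_max n :
  \sum_(1 <= a < n.+1) \sum_(1 <= c < n.+1) (gcdn a c)%:R / (maxn a c)%:R =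
  2 * (\sum_(1 <= d < n.+1) (totient d)%:R / d%:R * (n %/ d)%:R) - n%:R :> R.
Proof.
rewrite (@sum_square_symmetric _ (fun a c => (gcdn a c)%:R / (maxn a c)%:R)); last first.
  by move=> a c; rewrite gcdnC maxnC.
congr (2 * _ - _).
  transitivity (\sum_(1 <= c < n.+1) \sum_(1 <= d < n.+1 | (d %| c)%N)
      ((totient d)%:R / d%:R : R)).
    by apply: eq_big_nat => c cn; rewrite (@sum_totient_divisors_ratio c n).
  rewrite (exchange_big_dep xpredT)//=; apply: eq_big_nat => d /andP[d0 _].
  by rewrite sum_multiples// sumr_const_nat subn1 mulr_natr.
transitivity (\sum_(1 <= a < n.+1) (1 : R)).
  apply: eq_big_nat => a /andP[a0 _].
  by rewrite gcdnn maxnn divff// pnatr_eq0 -lt0n.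
by rewrite sumr_const_nat subn1.
Qed.

(** Replacing n/d by its integer part loses at most phi(d)/d <= 1 in each term. *)
Lemma totient_sum_floor_bounds n :
  n%:R * totient_sum R n - n%:R <=
    \sum_(1 <= d < n.+1) (totient d)%:R / d%:R * (n %/ d)%:R
  <= n%:R * totient_sum R n.
Proof.
have E : n%:R * totient_sum R n =
    \sum_(1 <= d < n.+1) (totient d)%:R / d%:R * (n%:R / d%:R).
  rewrite /totient_sum mulr_sumr; apply: eq_bigr => d _.
  by rewrite expr2 invfM; ring.
have nE : n%:R = \sum_(1 <= d < n.+1) 1 :> R by rewrite sumr_const_nat subn1.
rewrite E [X in _ - X]nE -sumrB.
apply/andP; split; apply: ler_sum_nat => d /andP[d0 _]; last first.
  by rewrite ler_wpM2l ?divr_ge0//; have /andP[] := divn_bounds n d0.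
have t0 : 0 <= (totient d)%:R / d%:R :> R by rewrite divr_ge0.
have t1 : (totient d)%:R / d%:R <= 1 :> R.
  by rewrite ler_pdivrMr ?ltr0n// mul1r ler_nat totient_le.
have /andP[h _] := divn_bounds n d0.
move: t0 t1 h; set u := _ / _; set v := n%:R / _; set w := (_)%:R; nra.
Qed.

(** Dropping the integer part in n div (max(a,c)/gcd(a,c)) costs at most 1 for
each of the n^2 pairs. *)
Lemma product_coincidences_bounds n :
  n%:R * (\sum_(1 <= a < n.+1) \sum_(1 <= c < n.+1)
            (gcdn a c)%:R / (maxn a c)%:R) - n%:R ^+ 2
  <= ((product_coincidences n)%:R : R)
  <= n%:R * (\sum_(1 <= a < n.+1) \sum_(1 <= c < n.+1)
               (gcdn a c)%:R / (maxn a c)%:R).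
Proof.
rewrite expr2 -mulrBr.
have sumC (f g : nat -> nat -> R) :
    (forall a c, (0 < a <= n)%N -> (0 < c <= n)%N -> f a c <= g a c) ->
    \sum_(1 <= a < n.+1) \sum_(1 <= c < n.+1) f a c <=
    \sum_(1 <= a < n.+1) \sum_(1 <= c < n.+1) g a c.
  move=> fg; apply: ler_sum_nat => a; rewrite ltnS => an.
  by apply: ler_sum_nat => c; rewrite ltnS => cn; exact: fg.
have bounds a c : (0 < a <= n)%N -> (0 < c <= n)%N ->
    n%:R * ((gcdn a c)%:R / (maxn a c)%:R) - 1 <=
    ((\sum_(1 <= b < n.+1) \sum_(1 <= d < n.+1) (a * b == c * d))%N%:R : R) <=
    n%:R * ((gcdn a c)%:R / (maxn a c)%:R).
  move=> an cn; rewrite count_equal_products//.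
  have /andP[a0 _] := an; have /andP[c0 _] := cn.
  have g0 : (0 < gcdn a c)%N by rewrite gcdn_gt0 a0.
  have gm : (gcdn a c %| maxn a c)%N.
    by rewrite /maxn; case: ifP => _; rewrite ?dvdn_gcdl ?dvdn_gcdr.
  have q0 : (0 < maxn a c %/ gcdn a c)%N.
    by rewrite divn_gt0// dvdn_leq// leq_max a0.
  have -> : (gcdn a c)%:R / (maxn a c)%:R =
            (maxn a c %/ gcdn a c)%:R^-1 :> R.
    have mE : (maxn a c)%:R = (maxn a c %/ gcdn a c)%:R * (gcdn a c)%:R :> R.
      by rewrite -natrM divnK.
    by rewrite mE invfM mulrCA divff ?mulr1// pnatr_eq0 -lt0n.
  exact: divn_bounds.
rewrite /product_coincidences natr_sum; under eq_bigr do rewrite natr_sum.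
apply/andP; split; last first.
  rewrite mulr_sumr; under [leRHS]eq_bigr do rewrite mulr_sumr.
  by apply: sumC => a c an cn; have /andP[] := bounds a c an cn.
have -> : n%:R * (\sum_(1 <= a < n.+1) \sum_(1 <= c < n.+1)
      (gcdn a c)%:R / (maxn a c)%:R - n%:R) =
    \sum_(1 <= a < n.+1) \sum_(1 <= c < n.+1)
      (n%:R * ((gcdn a c)%:R / (maxn a c)%:R) - 1) :> R.
  under [RHS]eq_bigr do rewrite sumrB sumr_const_nat subn1 -mulr_sumr.
  by rewrite sumrB sumr_const_nat subn1 -mulr_sumr mulrBr mulr_natr.
by apply: sumC => a c an cn; have /andP[] := bounds a c an cn.
Qed.

Lemma product_coincidences_asymptotic n : (0 < n)%N ->
  `|(product_coincidences n)%:R / 2 - 6 / pi ^+ 2 * n%:R ^+ 2 * ln n%:R|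
  <= 28 * n%:R ^+ 2 :> R.
Proof.
move=> n0; have := product_coincidences_bounds n.
rewrite sum_gcd_over_max; have := totient_sum_floor_bounds n.
have := totient_sum_asymptotic R n0; rewrite !ler_norml.
have : 1 <= n%:R :> R by rewrite ler1n.
move: (product_coincidences n)%:R (totient_sum _ _) (\sum_(_ <= _ < _) _).
set c := 6 / _; set L := ln _; move: (n%:R : R) c L.
move=> x c L E F S x1 /andP[F1 F2] /andP[S1 S2] /andP[E1 E2].
have h1 : x ^+ 2 * (F - c * L) <= x ^+ 2 * 26 by rewrite ler_wpM2l ?sqr_ge0.
have h2 : x ^+ 2 * (- 26) <= x ^+ 2 * (F - c * L) by rewrite ler_wpM2l ?sqr_ge0.
apply/andP; split; nra.
Qed.

(** For each c, the c terms with a <= c add up to 1, and symmetrically. *)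
Lemma sum_inv_max_le n :
  \sum_(1 <= a < n.+1) \sum_(1 <= c < n.+1) (maxn a c)%:R^-1 <= 2 * n%:R :> R.
Proof.
rewrite (@sum_square_symmetric _ (fun a c => (maxn a c)%:R^-1)); last first.
  by move=> a c; rewrite maxnC.
rewrite lerBlDr -[leLHS]addr0 lerD ?sumr_ge0// ler_pM2l//.
rewrite (_ : n%:R = \sum_(1 <= c < n.+1) 1); last by rewrite sumr_const_nat subn1.
apply: ler_sum_nat => c /andP[c0 _].
rewrite (eq_big_nat _ _ (F2 := fun=> c%:R^-1)); last first.
  by move=> a /andP[_ ac]; rewrite (maxn_idPr _).
by rewrite sumr_const_nat subn1 -[leLHS]mulr_natr mulVf// pnatr_eq0 -lt0n.
Qed.

Lemma product_sums_to_le n p : prime p -> (n < p)%N ->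
  (product_sums_to n p)%:R <= 3 * n%:R ^+ 2 :> R.
Proof.
move=> pp np.
apply: (@le_trans _ _ (\sum_(1 <= a < n.+1) \sum_(1 <= c < n.+1)
    (n%:R * (maxn a c)%:R^-1 + 1))).
  rewrite /product_sums_to natr_sum; apply: ler_sum_nat => a an.
  rewrite natr_sum; apply: ler_sum_nat => c cn; rewrite !ltnS in an cn.
  have /andP[a0 _] := an.
  apply: (@le_trans _ _ (n %/ maxn a c + 1)%:R).
    by rewrite ler_nat count_products_sum_to.
  have m0 : (0 < maxn a c)%N by rewrite leq_max a0.
  by rewrite natrD lerD2r; have /andP[] := divn_bounds n m0.
under eq_bigr do rewrite big_split /= -mulr_sumr sumr_const_nat subn1.
rewrite big_split /= -mulr_sumr sumr_const_nat subn1 /= -[X in _ + X]mulr_natr.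
have := sum_inv_max_le n; have : 0 <= n%:R :> R by [].
move: (\sum_(_ <= _ < _) _) => S; nra.
Qed.
End real_counts.

(** * The two asymptotic formulas *)

Lemma fourth_moment_asymptotic (R : realType) (p n : nat) (e : bool) :
  prime p -> (0 < n)%N -> n%:R < Num.sqrt (p%:R : R) ->
  `| (p%:R - 1)^-1 *
       (\sum_(chi \in [set chi : int -> R[i] |
                dirichlet_character p chi /\ chi (-1) = (-1) ^+ e])
          ComplexField.Normc.normc (\sum_(1 <= m < n.+1) chi m%:Z) ^+ 4)
     - 6 / pi ^+ 2 * n%:R ^+ 2 * ln n%:R | <= 30 * n%:R ^+ 2.
Proof.
move=> pp n0 nsqrt.
have n2p : (n ^ 2 < p)%N.
  by rewrite -(ltr_nat R) natrX -[ltRHS]sqr_sqrtr// ltr_pXn2r// ?nnegrE ?sqrtr_ge0.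
have np : (n < p)%N by apply: leq_ltn_trans n2p; nia.
have := fourth_moment R e pp n2p; rewrite /character_sum => ->.
have p1 : p%:R - 1 != 0 :> R.
  by rewrite subr_eq0 pnatr_eq1; have := prime_gt1 pp; lia.
rewrite mulrA mulrA mulVf// mul1r.
have := product_coincidences_asymptotic R n0.
have := product_sums_to_le R pp np.
have : 0 <= (product_sums_to n p)%:R :> R by [].
move: (product_coincidences n)%:R (product_sums_to n p)%:R => E N.
have := sqr_ge0 (n%:R : R); move: (n%:R ^+ 2) (6 / pi ^+ 2 * n%:R ^+ 2 * ln n%:R) => x L.
rewrite !ler_norml; case: e; rewrite ?expr1 ?expr0; lra.
Qed.

Theorem corollary1p12 (R : realType) :
  (exists C : R, forall p n : nat,
     prime p -> (0 < n)%N -> n%:R < Num.sqrt (p%:R : R) ->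
     `| (p%:R - 1)^-1 *
          (\sum_(chi \in even_characters R p)
             ComplexField.Normc.normc (\sum_(1 <= m < n.+1) chi m%:Z) ^+ 4)
        - 6 / pi ^+ 2 * n%:R ^+ 2 * ln n%:R | <= C * n%:R ^+ 2) /\
  (exists C : R, forall p n : nat,
     prime p -> (0 < n)%N -> n%:R < Num.sqrt (p%:R : R) ->
     `| (p%:R - 1)^-1 *
          (\sum_(chi \in odd_characters R p)
             ComplexField.Normc.normc (\sum_(1 <= m < n.+1) chi m%:Z) ^+ 4)
        - 6 / pi ^+ 2 * n%:R ^+ 2 * ln n%:R | <= C * n%:R ^+ 2).
Proof.
split; exists 30 => p n pp n0 np.
- exact: (fourth_moment_asymptotic false pp n0 np).
- exact: (fourth_moment_asymptotic true pp n0 np).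
Qed.
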